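(* The asymptotic competitive ratio of every deterministic online algorithm for the online minimum peak appointment scheduling problem (MPAS) is at least $1.25$.
   Context: MPAS: items arrive one by one, each with a size $s\in(0,1]$. Upon arrival, the online algorithm must irrevocably assign the item an interval $[x,x+s)$ with $0\le x\le 1-s$, before the next item arrives. The cost of an assignment is the maximum, over points $z\in[0,1)$, of the number of assigned intervals containing $z$ (equivalently, the minimum number of bins $[0,1)$ into which the intervals can be placed so that intervals in the same bin are pairwise disjoint). $\mathrm{OPT}(I)$ is the minimum cost over all assignments of intervals to the items of input $I$. The asymptotic competitive ratio of an algorithm $A$ is $\limsup_{n\to\infty}\sup_{I:\mathrm{OPT}(I)\ge n} A(I)/\mathrm{OPT}(I)$ (for randomized algorithms, $A(I)$ is replaced by its expectation); equivalently, the infimum of $R$ such that $A(I)\le R\cdot\mathrm{OPT}(I)+C$ for some constant $C$ and all inputs $I$. *)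

(* Defs.v *)
From mathcomp Require Import all_boot all_order all_algebra.
From mathcomp Require Import all_classical all_reals all_analysis.

Set Implicit Arguments.
Unset Strict Implicit.
Unset Printing Implicit Defensive.

Import Order.TTheory GRing.Theory Num.Theory.

Local Open Scope classical_set_scope.
Local Open Scope ring_scope.

Section MPAS.
Variable R : realType.

Definition is_size (s : R) : bool := 0 < s <= 1.

(* An input is the sequence of item sizes, in order of arrival. *)
Definition is_input (I : seq R) : bool := all is_size I.

Definition admissible (x s : R) : bool := 0 <= x <= 1 - s.

(* The number of intervals [x, x + s) of the list a of pairs (x, s) that
   contain z. *)
Definition load (a : seq (R * R)) (z : R) : nat :=
  count (fun p => z \in `[p.1, p.1 + p.2[) a.

Definition is_load (a : seq (R * R)) (k : nat) : bool :=
  `[< exists2 z : R, z \in `[0, 1[ & load a z = k >].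

Lemma is_load_ex a : exists k, is_load a k.
Proof.
by exists (load a 0); apply/asboolP; exists 0; rewrite // in_itv /= lexx ltr01.
Qed.

Lemma is_load_le a k : is_load a k -> (k <= size a)%N.
Proof. by move/asboolP => [z _ <-]; exact: count_size. Qed.

Definition peak (a : seq (R * R)) : nat :=
  ex_maxn (is_load_ex a) (@is_load_le a).

Definition is_assignment (I xs : seq R) : bool := all2 admissible xs I.

Definition cost (I xs : seq R) : nat := peak (zip xs I).

Definition is_cost (I : seq R) (k : nat) : bool :=
  `[< exists2 xs, is_assignment I xs & cost I xs = k >].

Lemma is_cost_ex I : is_input I -> exists k, is_cost I k.
Proof.
move=> hI; exists (cost I (nseq (size I) 0)); apply/asboolP.
exists (nseq (size I) 0) => //; elim: I hI => //= s I IH /andP[/andP[_ s1] /IH].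
by move=> hI; apply/andP; split => //; rewrite /admissible lexx subr_ge0.
Qed.

Definition OPT (I : seq R) (hI : is_input I) : nat := ex_minn (is_cost_ex hI).

(* A deterministic online algorithm: place past s is the left endpoint given to
   an arriving item of size s after items of sizes past (in order of arrival).
   The earlier assignments are determined by past, so they are not a further
   argument. *)
Record online_algorithm := OnlineAlgorithm {
  place :> seq R -> R -> R;
  place_admissible : forall past s,
    is_input past -> is_size s -> admissible (place past s) s
}.

Definition run (A : online_algorithm) (I : seq R) : seq R :=
  [seq A (take i I) (nth 0 I i) | i <- iota 0 (size I)].

Definition alg_cost (A : online_algorithm) (I : seq R) : nat := cost I (run A I).

Definition asymptotic_competitive_ratio (A : online_algorithm) : \bar R :=
  limn_esup (fun n : nat =>
    ereal_sup [set r | exists (I : seq R) (hI : is_input I),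
      (n <= OPT hI)%N /\ r = ((alg_cost A I)%:R / (OPT hI)%:R)%:E]).

End MPAS.

(* Main.v *)
(* The adversary first sends 20k items of size 1/5, which fit in 4k bins. If the
   algorithm keeps its peak below 5k, then fewer than 15k of them lie strictly
   left of 2/5, strictly right of 3/5, or exactly on [2/5, 3/5), so more than 5k
   pass over points just left of 2/5 or at and just right of 3/5.
   Next come 120k items of sizes barely below 2/5, found by bisection so that
   each of those placed on the left is smaller than each of those placed on the
   right; two of them and a 1/5 share a bin, so 60k bins suffice. The l left ones
   add up with the fifths near 2/5, hence l < 75k unless the peak reaches 75k.
   Finally l items of size 1 - t are sent, with t separating the left from the
   right sizes. An optimal packing pairs each with a left item, whereas in the
   algorithm's assignment all of them, all right items and the fifths near 3/5
   share a point, 1 - hi with hi the smallest right size. *)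

Require Import Defs.
From mathcomp Require Import all_boot all_order all_algebra.
From mathcomp Require Import all_classical all_reals all_analysis.
From mathcomp Require Import lra zify.

Import Order.TTheory GRing.Theory Num.Theory.

Local Open Scope ring_scope.

(* l and r count the small and large second-phase items, u and v the fifths
   present at the two points where the load is measured. *)
Lemma final_load_bound k l r u v h opt alg :
  (20 * k <= 3 * (5 * k) + u + v -> u + l < 75 * k -> l + r = 120 * k ->
   h + h <= r.+1 -> opt <= l + h -> v + r + l <= alg -> 5 * opt <= 4 * alg)%N.
Proof. lia. Qed.

Lemma uphalf_bounds n : (n <= uphalf n + uphalf n <= n.+1)%N.
Proof. by rewrite uphalf_half -{1 4}(odd_double_half n) -addnn; lia. Qed.

(** * Loads, peaks and upper bounds on the optimum *)

Section Assignments.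
Variable R : realType.
Implicit Types (a : seq (R * R)) (I : seq R) (z s t : R).

Lemma load_cat a b z : load (a ++ b) z = (load a z + load b z)%N.
Proof. exact: count_cat. Qed.

Lemma load_rcons a p z :
  load (rcons a p) z = (load a z + (z \in `[p.1, p.1 + p.2[)%R)%N.
Proof. by rewrite -cats1 load_cat /load /= addn0. Qed.

Lemma load_eq0 a z :
  {in a, forall p, z \notin `[p.1, p.1 + p.2[} -> load a z = 0%N.
Proof.
move=> h; apply/eqP; rewrite -leqn0 leqNgt -has_count.
by apply/hasPn => p /h.
Qed.

Lemma peakP a : exists2 z : R, z \in `[0, 1[ & load a z = peak a.
Proof. by rewrite /peak; case: ex_maxnP => k /asboolP. Qed.

Lemma load_le_peak a z : z \in `[0, 1[ -> (load a z <= peak a)%N.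
Proof.
by move=> hz; rewrite /peak; case: ex_maxnP => k _; apply; apply/asboolP; exists z.
Qed.

(** Loads do not depend on order, so a packing listed in any order can be rearranged into the order
    of arrival. *)
Lemma OPT_le I (hI : is_input I) a k :
  {in a, forall p, admissible p.1 p.2} -> perm_eq I [seq p.2 | p <- a] ->
  (forall z, 0 <= z < 1 -> (load a z <= k)%N) -> (OPT hI <= k)%N.
Proof.
move=> adm /(perm_iotaP 0); rewrite size_map => -[Is pIs EI] hk.
pose b := [seq nth (0, 0) a i | i <- Is].
have pb : perm_eq b a by apply/(perm_iotaP (0, 0)); exists Is.
have Eb : I = [seq p.2 | p <- b].
  rewrite EI /b -map_comp; apply/eq_in_map => i.
  rewrite (perm_mem pIs) mem_iota /= add0n => hi.
  by rewrite (nth_map (0, 0)).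
have asg : is_assignment I [seq p.1 | p <- b].
  have : {in b, forall p, admissible p.1 p.2}.
    by move=> p; rewrite (perm_mem pb); exact: adm.
  rewrite Eb /is_assignment; elim: (b) => //= p c IH h.
  by rewrite h ?mem_head //= IH // => q qc; rewrite h // inE qc orbT.
have Ez : zip [seq p.1 | p <- b] I = b.
  by rewrite Eb; elim: (b) => //= -[x y] c ->.
rewrite /OPT; case: ex_minnP => m _ /(_ (cost I [seq p.1 | p <- b])) hm.
apply: (leq_trans (hm _)); first by apply/asboolP; exists [seq p.1 | p <- b].
rewrite /cost Ez; have [z hz <-] := peakP b.
by rewrite /load (permP pb) hk //; rewrite in_itv /= in hz.
Qed.

(** * A lower bound on the optimum by counting at five points *)

Lemma hits_fifth x s : admissible x s -> 1 / 5 <= s ->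
  exists j : 'I_5, x <= j%:R / 5 < x + s.
Proof.
move=> /andP[x0 x1] hs.
have [e0|e0] := leP x 0; first by exists ord0; rewrite /=; lra.
have [e1|e1] := leP x (1 / 5); first by exists (inord 1); rewrite inordK //; lra.
have [e2|e2] := leP x (2 / 5); first by exists (inord 2); rewrite inordK //; lra.
have [e3|e3] := leP x (3 / 5); first by exists (inord 3); rewrite inordK //; lra.
by exists (inord 4); rewrite inordK //; lra.
Qed.

Lemma size_le_loads (zs : seq R) a :
  {in a, forall p, exists2 z, z \in zs & z \in `[p.1, p.1 + p.2[} ->
  (size a <= \sum_(z <- zs) load a z)%N.
Proof.
elim: a => //= p a IH h; rewrite big_split -add1n leq_add //=; last first.
  by apply: IH => q qa; apply: h; rewrite inE qa orbT.
by have [z zs_z hz] := h p (mem_head _ _); rewrite (big_rem z) //= hz.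
Qed.

(** Every interval contains a multiple of 1/5 in [0, 4/5], so the loads at these five points add up
    to at least the number of items, and each is at most the cost. *)
Lemma size_le_OPT I (hI : is_input I) :
  {in I, forall s, 1 / 5 <= s} -> (size I <= 5 * OPT hI)%N.
Proof.
move=> h5; rewrite /OPT; case: ex_minnP => m /asboolP[xs].
rewrite /is_assignment all2E => /andP[/eqP sz /allP adm] <- _.
have -> : size I = size (zip xs I) by rewrite size_zip -sz minnn.
pose zs := [seq j%:R / 5 : R | j <- iota 0 5].
have -> : (5 * cost I xs = \sum_(z <- zs) cost I xs)%N.
  by rewrite big_const_seq count_predT iter_addn_0 mulnC.
apply: (@leq_trans (\sum_(z <- zs) load (zip xs I) z)).
  apply: size_le_loads => p hp.
  have p2 : p.2 \in I by rewrite -(@unzip2_zip _ _ xs I) ?map_f // sz.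
  have [j hj] := hits_fifth _ _ (adm p hp) (h5 _ p2).
  exists (j%:R / 5); last by rewrite in_itv.
  by apply/mapP; exists (j : nat); rewrite // mem_iota /=.
rewrite big_seq [leqRHS]big_seq; apply: leq_sum => z /mapP[j].
rewrite mem_iota /= => hj ->; apply: load_le_peak; rewrite in_itv /=.
have : (j%:R <= 4 :> R) by rewrite (ler_nat R j 4) -ltnS.
by have : (0 <= j%:R :> R) by []; lra.
Qed.

(** * Explicit offline packings *)

Lemma OPT_fifths k (hI : is_input (nseq (5 * k) (1 / 5 : R))) : (OPT hI <= k)%N.
Proof.
(* Five stacks of height [k] tile [0, 1). *)
pose a := flatten [seq nseq k (j%:R / 5 : R, 1 / 5 : R) | j <- iota 0 5].
apply: (@OPT_le _ _ a) => [p /flatten_mapP[j] | | z /andP[z0 z1]].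
- rewrite mem_iota => hj /nseqP[-> _] /=; rewrite /admissible.
  have : (j%:R <= 4 :> R) by rewrite (ler_nat R j 4); lia.
  by have : (0 <= j%:R :> R) by []; lra.
- rewrite /a /= cats0 !map_cat !map_nseq -!nseqD.
  by have -> : (k + (k + (k + (k + k))) = 5 * k)%N by lia.
- rewrite /a /= cats0 !load_cat /load !count_nseq !in_itv /=.
  rewrite mulr0n mul0r mulr1n.
  have [e1|e1] := ltP z (1 / 5).
    have -> : (2 / 5 <= z) = false by lra.
    have -> : (3 / 5 <= z) = false by lra.
    have -> : (4 / 5 <= z) = false by lra.
    by rewrite /=; case: (_ && _); lia.
  have -> : (z < 0 + 1 / 5) = false by lra.
  have [e2|e2] := ltP z (2 / 5).
    have -> : (3 / 5 <= z) = false by lra.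
    have -> : (4 / 5 <= z) = false by lra.
    by rewrite /= !andbF; case: (z < _); lia.
  have -> : (z < 1 / 5 + 1 / 5) = false by lra.
  have [e3|e3] := ltP z (3 / 5).
    have -> : (4 / 5 <= z) = false by lra.
    by rewrite /= !andbF; case: (z < _); lia.
  have -> : (z < 2 / 5 + 1 / 5) = false by lra.
  have [e4|e4] := ltP z (4 / 5).
    by rewrite /= !andbF; case: (z < _); lia.
  have -> : (z < 3 / 5 + 1 / 5) = false by lra.
  by rewrite /= !andbF; case: (z < _); lia.
Qed.

(* Each size in Ls is packed with a 1 - t; those in Rs are packed in pairs,
   with at most one 1/5 in the middle. *)
Lemma OPT_pairs t n h (Ls Rs I : seq R) (hI : is_input I) :
  0 < t <= 2 / 5 -> {in Ls, forall s, 0 < s <= t} ->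
  {in Rs, forall s, 0 < s <= 2 / 5} -> (n <= h)%N -> (size Rs <= h + h)%N ->
  perm_eq I (nseq n (1 / 5) ++ (Ls ++ Rs) ++ nseq (size Ls) (1 - t)) ->
  (OPT hI <= size Ls + h)%N.
Proof.
move=> /andP[t0 t1] hL hR hn hh hperm.
pose a1 := nseq n (2 / 5 : R, 1 / 5 : R).
pose a2 := [seq (0 : R, s) | s <- Ls].
pose a3 := [seq (0 : R, s) | s <- take h Rs].
pose a4 := [seq (1 - s, s) | s <- drop h Rs].
pose a5 := nseq (size Ls) (t, 1 - t).
have m1 p : p \in a1 -> p = (2 / 5, 1 / 5) by case/nseqP.
have m2 p : p \in a2 -> p.1 = 0 /\ 0 < p.2 <= t.
  by case/mapP => s /hL hs ->.
have m3 p : p \in a3 -> p.1 = 0 /\ 0 < p.2 <= 2 / 5.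
  by case/mapP => s /mem_take /hR hs ->.
have m4 p : p \in a4 -> p.1 = 1 - p.2 /\ 0 < p.2 <= 2 / 5.
  by case/mapP => s /mem_drop /hR hs ->.
have m5 p : p \in a5 -> p = (t, 1 - t) by case/nseqP.
apply: (@OPT_le _ _ (a1 ++ (a2 ++ a3 ++ a4) ++ a5)) => [p | | z /andP[z0 z1]].
- rewrite /admissible !mem_cat => /orP[/m1 -> /=|/orP[/orP[/m2|/orP[/m3|/m4]]|/m5 -> /=]].
  + by lra.
  + by case=> ->; lra.
  + by case=> ->; lra.
  + by case=> ->; lra.
  + by lra.
- apply: (perm_trans hperm); rewrite !map_cat !map_nseq /=.
  have -> : [seq p.2 | p <- a2] = Ls by rewrite -map_comp map_id.
  have -> : [seq p.2 | p <- a3] = take h Rs by rewrite -map_comp map_id.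
  have -> : [seq p.2 | p <- a4] = drop h Rs by rewrite -map_comp map_id.
  by rewrite cat_take_drop.
- have s1 : (load a1 z <= n)%N by rewrite (leq_trans (count_size _ _)) ?size_nseq.
  have s2 : (load a2 z <= size Ls)%N.
    by rewrite (leq_trans (count_size _ _)) ?size_map.
  have s3 : (load a3 z <= h)%N.
    by rewrite (leq_trans (count_size _ _)) ?size_map // size_take_min geq_minl.
  have s4 : (load a4 z <= h)%N.
    by rewrite (leq_trans (count_size _ _)) ?size_map // size_drop leq_subLR.
  have s5 : (load a5 z <= size Ls)%N.
    by rewrite (leq_trans (count_size _ _)) ?size_nseq.
  rewrite !load_cat.
  have l1 : z < 2 / 5 -> load a1 z = 0%N.
    by move=> hz; apply: load_eq0 => p /m1 ->; rewrite in_itv /=; lra.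
  have l1' : 3 / 5 <= z -> load a1 z = 0%N.
    by move=> hz; apply: load_eq0 => p /m1 ->; rewrite in_itv /=; lra.
  have l2 : t <= z -> load a2 z = 0%N.
    by move=> hz; apply: load_eq0 => p /m2[-> ?]; rewrite in_itv /=; lra.
  have l3 : 2 / 5 <= z -> load a3 z = 0%N.
    by move=> hz; apply: load_eq0 => p /m3[-> ?]; rewrite in_itv /=; lra.
  have l4 : z < 3 / 5 -> load a4 z = 0%N.
    by move=> hz; apply: load_eq0 => p /m4[-> ?]; rewrite in_itv /=; lra.
  have l5 : z < t -> load a5 z = 0%N.
    by move=> hz; apply: load_eq0 => p /m5 ->; rewrite in_itv /=; lra.
  (* The groups that can cover [z] are [a2], [a3] below [t]; [a3], [a5] up to 2/5; [a1], [a5] up to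
     3/5; and [a4], [a5] beyond. *)
  have [zt|zt] := ltP z t.
    by rewrite l1 ?l4 ?l5 ?addn0 ?add0n ?leq_add //; lra.
  rewrite l2 //; have [z2|z2] := ltP z (2 / 5).
    by rewrite l1 ?l4 ?addn0 ?add0n 1?addnC ?leq_add //; lra.
  rewrite l3 //; have [z3|z3] := ltP z (3 / 5).
    by rewrite l4 // !add0n addnC leq_add // (leq_trans s1).
  by rewrite l1' // !add0n addnC leq_add.
Qed.

(** * Intervals of length 1/5 near 2/5 and 3/5 *)

Lemma pos_lower_bound (r : seq R) :
  exists2 e : R, 0 < e & {in r, forall x, 0 < x -> e <= x}.
Proof.
elim: r => [|y r [e e0 he]]; first by exists 1.
have [y0|y0] := ltP 0 y.
  exists (Num.min e y); first by rewrite lt_min e0.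
  move=> x; rewrite inE => /orP[/eqP-> _|/he h /h hx]; first by rewrite ge_min lexx orbT.
  by rewrite ge_min hx.
exists e => // x; rewrite inE => /orP[/eqP->|/he //].
by rewrite ltNge y0.
Qed.

(* The three terms n bound the intervals lying left of 2/5 - e, equal to
   [2/5, 3/5), or lying right of 3/5. *)
Lemma crossing_fifths a n :
  {in a, forall p, p.2 = 1 / 5 /\ 0 <= p.1 <= 4 / 5} -> (peak a <= n)%N ->
  exists2 e : R, 0 < e <= 1 / 15 & forall z, 3 / 5 <= z <= 3 / 5 + e ->
   (size a <= 3 * n + load a (2 / 5 - e)%R + load a z)%N.
Proof.
move=> ha hn.
pose r := [seq 1 / 5 - p.1 | p <- a] ++ [seq 2 / 5 - p.1 | p <- a] ++
          [seq p.1 - 2 / 5 | p <- a].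
have [d d0 hd] := pos_lower_bound r.
(* Halving [d] gives [e < d], needed because intervals are open on the right and must still contain
   [3 / 5 + e]. The cap 1/15 makes [2 / 5 - e >= 1 / 3], as the bisection requires. *)
pose e := Num.min (d / 2) (1 / 15).
have [e0 ed e15] : [/\ 0 < e, e <= d / 2 & e <= 1 / 15].
  by split; rewrite /e ?ge_min ?lexx ?orbT // lt_min; lra.
exists e => [|z hz]; first by rewrite e0.
have hle y : 0 <= y < 1 -> (load a y <= n)%N.
  by move=> hy; apply: (leq_trans (load_le_peak a y _)) => //; rewrite in_itv.
have h := size_le_loads [:: 1 / 5 - e; 1 / 2; 4 / 5; 2 / 5 - e; z] a.
rewrite !big_cons big_nil addn0 in h.
apply: (@leq_trans (n + (n + (n + (load a (2 / 5 - e) + load a z))))); last first.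
  by rewrite !addnA; have -> : (3 * n = n + n + n)%N by lia.
apply: (leq_trans (h _)) => {h}; last first.
  by rewrite !leq_add // hle //; lra.
move=> p pa; have [-> /andP[x0 x1]] := ha p pa.
have d1 : 0 < 1 / 5 - p.1 -> d <= 1 / 5 - p.1.
  by apply: hd; rewrite mem_cat (map_f (fun p => 1 / 5 - p.1)).
have d2 : 0 < 2 / 5 - p.1 -> d <= 2 / 5 - p.1.
  by apply: hd; rewrite !mem_cat (map_f (fun p => 2 / 5 - p.1)) ?orbT.
have d3 : 0 < p.1 - 2 / 5 -> d <= p.1 - 2 / 5.
  by apply: hd; rewrite !mem_cat (map_f (fun p => p.1 - 2 / 5)) ?orbT.
have [c1|c1] := ltP p.1 (1 / 5).
  exists (1 / 5 - e); first by rewrite !inE eqxx ?orbT.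
  by have := d1 _; rewrite in_itv /= subr_gt0 c1 => /(_ isT); lra.
have [c2|c2] := ltP p.1 (2 / 5).
  exists (2 / 5 - e); first by rewrite !inE eqxx ?orbT.
  by have := d2 _; rewrite in_itv /= subr_gt0 c2 => /(_ isT); lra.
have [c3|c3] := leP p.1 (2 / 5).
  exists (1 / 2); first by rewrite !inE eqxx ?orbT.
  by rewrite in_itv /=; lra.
have [c4|c4] := leP p.1 (3 / 5).
  exists z; first by rewrite !inE eqxx ?orbT.
  by have := d3 _; rewrite in_itv /= subr_gt0 c3 => /(_ isT); lra.
exists (4 / 5); first by rewrite !inE eqxx ?orbT.
by rewrite in_itv /=; lra.
Qed.

End Assignments.

(** * Online runs and the adversary's strategy *)

Section Adversary.
Variables (R : realType) (A : online_algorithm R).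
Implicit Types (I S W : seq R) (s z : R).

(** Earlier placements ignore later items, so the adversary may adapt to them while extending the
    input. *)
Lemma run_rcons I s : run A (rcons I s) = rcons (run A I) (A I s).
Proof.
rewrite /run size_rcons -addn1 iotaD map_cat cats1 /= add0n.
have -> : take (size I) (rcons I s) = I by rewrite -cats1 take_size_cat.
rewrite nth_rcons ltnn eqxx; congr rcons.
apply/eq_in_map => i; rewrite mem_iota /= add0n => hi.
by rewrite nth_rcons hi -cats1 takel_cat // ltnW.
Qed.

Lemma size_run I : size (run A I) = size I.
Proof. by rewrite size_map size_iota. Qed.

Definition placed I := zip (run A I) I.

Lemma placed_rcons I s : placed (rcons I s) = rcons (placed I) (A I s, s).
Proof. by rewrite /placed run_rcons zip_rcons // size_run. Qed.

Lemma placed_admissible I : is_input I ->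
  {in placed I, forall p, admissible p.1 p.2 /\ p.2 \in I}.
Proof.
elim/last_ind: I => [//|I s IH]; rewrite /is_input all_rcons => /andP[hs hI] p.
rewrite placed_rcons mem_rcons inE => /orP[/eqP -> /=|/(IH hI)[? pI]].
  by split; [exact: place_admissible | rewrite mem_rcons mem_head].
by split; rewrite // mem_rcons inE pI orbT.
Qed.

Lemma load_le_alg_cost I z :
  0 <= z < 1 -> (load (placed I) z <= alg_cost A I)%N.
Proof. by move=> hz; apply: load_le_peak; rewrite in_itv. Qed.

(* All placements of an interval of length s > 1/2 contain [1 - s, s). *)
Lemma load_placed_nseq I s m z : is_input I -> is_size s -> 1 - s <= z < s ->
  (load (placed I) z + m <= load (placed (I ++ nseq m s)) z)%N.
Proof.
move=> hI hs hz; elim: m => [|m IH]; first by rewrite cats0 addn0.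
have hm : is_input (I ++ nseq m s).
  by rewrite /is_input all_cat all_nseq hs orbT andbT.
rewrite -addn1 nseqD catA cats1 placed_rcons load_rcons addnA leq_add //=.
have /andP[x0 x1] := @place_admissible _ A _ _ hm hs.
by rewrite in_itv /=; have -> : A (I ++ nseq m s) s <= z < A (I ++ nseq m s) s + s by lra.
Qed.

(* Bisection: an item reaching beyond 1 - lo0 is declared large (joins Rs) and
   all later items are smaller; the others are declared small, and all later
   items are larger. *)
Lemma adversary W lo0 hi0 N : is_input W -> 1 / 3 <= lo0 < hi0 -> hi0 <= 1 / 2 ->
  exists lo hi Ls Rs S,
  [/\ [/\ lo0 <= lo, lo < hi & hi <= hi0],
      size S = N /\ perm_eq S (Ls ++ Rs),
      {in Ls, forall s, lo0 <= s <= lo} /\ {in Rs, forall s, hi <= s <= hi0},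
      (load (placed W) lo0 + size Ls <= load (placed (W ++ S)) lo0)%N &
      forall z, 1 - hi <= z <= 1 - lo0 ->
        (load (placed W) z + size Rs <= load (placed (W ++ S)) z)%N].
Proof.
move=> hW /andP[lo03 lohi0] hi02; elim: N => [|N].
  exists lo0, hi0, [::], [::], [::]; rewrite /= cats0 addn0; split => //.
  by move=> z _; rewrite addn0.
move=> [lo [hi [Ls [Rs [S [[lo0lo lohi hihi0] [szS pS] [hL hR] cL cR]]]]]].
pose s := (lo + hi) / 2; pose x := A (W ++ S) s.
have [los shi] : lo < s /\ s < hi by rewrite /s; split; lra.
have hS : is_input (W ++ S).
  rewrite /is_input all_cat [all _ W]hW (perm_all _ pS) all_cat /=.
  apply/andP; split; apply/allP => u; rewrite /is_size; first by move=> /hL; lra.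
  by move=> /hR; lra.
have hs : is_size s by rewrite /is_size; lra.
have /andP[x0 x1] := @place_admissible _ A _ _ hS hs.
have EW : placed (W ++ rcons S s) = rcons (placed (W ++ S)) (x, s).
  by rewrite -rcons_cat placed_rcons.
rewrite -/x in x0 x1.
(* A large item has [x <= 1 - s], so it covers all of [1 - s, 1 - lo0], the range required once [hi]
   becomes [s]. *)
have [hx|hx] := ltP (1 - lo0) (x + s).
  exists lo, s, Ls, (s :: Rs), (rcons S s); split => //.
  - by split => //; lra.
  - rewrite size_rcons szS; split => //.
    by rewrite perm_rcons perm_sym -cat1s perm_catCA /= perm_cons perm_sym.
  - split => // u; rewrite inE => /orP[/eqP ->|/hR]; lra.
  - by rewrite EW load_rcons (leq_trans cL) ?leq_addr.
  - move=> z hz; rewrite EW load_rcons in_itv /= -addn1 addnA leq_add ?cR //; first lra.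
    by have -> : x <= z < x + s by lra.
(* A small item contains [lo0]: [x <= 1 - lo0 - s < 1 - 2 * lo0 <= lo0 < s], by [1 / 3 <= lo0]. *)
exists s, hi, (s :: Ls), Rs, (rcons S s); split => //.
- by split => //; lra.
- by rewrite size_rcons szS perm_rcons perm_cons.
- split => // u; rewrite inE => /orP[/eqP ->|/hL]; lra.
- rewrite EW load_rcons in_itv /= -addn1 addnA leq_add //.
  by have -> : x <= lo0 < x + s by lra.
- by move=> z hz; rewrite EW load_rcons (leq_trans (cR _ _)) ?leq_addr.
Qed.

Lemma bad_input n : exists (I : seq R) (hI : is_input I),
  (n < OPT hI)%N /\ (5 * OPT hI <= 4 * alg_cost A I)%N.
Proof.
pose k := n.+1.
have OPT_gt I (hI : is_input I) :
    {in I, forall s, 1 / 5 <= s} -> (20 * k <= size I)%N -> (n < OPT hI)%N.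
  by move=> /(size_le_OPT R I hI); rewrite /k; lia.
pose W := nseq (5 * (4 * k)) (1 / 5 : R).
have szW : size W = (20 * k)%N by rewrite size_nseq; lia.
have EW : W = nseq (20 * k) (1 / 5) by rewrite /W mulnA.
have W5 s : s \in W -> s = 1 / 5 by case/nseqP.
have hW : is_input W by apply/allP => s /W5 ->; rewrite /is_size; lra.
(* Stopping here already gives the ratio 5k / 4k. *)
have [bigW|smallW] := leqP (5 * k) (alg_cost A W).
  exists W, hW; split; first by apply: OPT_gt; rewrite ?szW // => s /W5 ->.
  have hO : (OPT hW <= 4 * k)%N := OPT_fifths R (4 * k) hW.
  by lia.
have [p /placed_admissible[] // /andP[? ?] /W5 E|e he] :=
  @crossing_fifths _ (placed W) (5 * k) _ (ltnW smallW).
  by rewrite E; split; lra.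
rewrite size_zip size_run szW minnn => cross.
have [||lo [hi [Ls [Rs [S [[lo0 lohi hi0] [szS pS] [hL hR] cL cR]]]]]] :=
  @adversary W (2 / 5 - e) (2 / 5) (120 * k) hW; [lra | lra |].
have szLR : (size Ls + size Rs = 120 * k)%N.
  by rewrite -szS -size_cat; exact/esym/perm_size.
have S25 s : s \in S -> 1 / 3 <= s <= 2 / 5.
  by rewrite (perm_mem pS) mem_cat => /orP[/hL|/hR]; lra.
have I5 s : s \in W ++ S -> 1 / 5 <= s.
  by rewrite mem_cat => /orP[/W5 ->|/S25]; lra.
have hI : is_input (W ++ S).
  apply/allP => s sI; rewrite /is_size; have := I5 s sI.
  by move: sI; rewrite mem_cat => /orP[/W5 ->|/S25]; lra.
(* Stopping here gives 75k / 60k; the packing is the paired one with no small items. *)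
have [bigI|smallI] := leqP (75 * k) (alg_cost A (W ++ S)).
  exists (W ++ S), hI; split.
    by apply: OPT_gt => //; rewrite size_cat szW leq_addr.
  suff : (OPT hI <= 60 * k)%N by lia.
  apply: (@OPT_pairs _ (2 / 5) (20 * k) (60 * k) [::] S) => //.
  - lra.
  - by move=> s /S25; lra.
  - by rewrite leq_mul2r orbT.
  - by rewrite szS -mulnDl.
  - by rewrite EW [nseq (size _) _]/= cats0.
pose t := (lo + hi) / 2.
have [lot thi] : lo < t /\ t < hi by rewrite /t; split; lra.
pose J := (W ++ S) ++ nseq (size Ls) (1 - t).
have ht : is_size (1 - t) by rewrite /is_size; lra.
have hJ : is_input J by rewrite /is_input all_cat [all _ _]hI all_nseq ht orbT.
exists J, hJ; split.
  apply: OPT_gt; last by rewrite !size_cat szW -addnA leq_addr.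
  by move=> s; rewrite mem_cat => /orP[/I5 //|/nseqP[-> _]]; lra.
have loadS : (load (placed W) (2 / 5 - e) + size Ls < 75 * k)%N.
  apply: leq_ltn_trans smallI; apply: leq_trans cL _.
  by apply: load_le_alg_cost; lra.
pose h := uphalf (size Rs); have /andP[hRs hRs2] := uphalf_bounds (size Rs).
(* More than 45k items are large, so the bins holding them in pairs have room for all the fifths. *)
have nh : (20 * k <= h)%N.
  have : (size Ls < 75 * k)%N by apply: leq_ltn_trans loadS; rewrite leq_addl.
  by move: szLR hRs; rewrite -/h; clear; lia.
have OPTJ : (OPT hJ <= size Ls + h)%N.
  apply: (@OPT_pairs _ t (20 * k) h Ls Rs) => //.
  - lra.
  - by move=> s /hL; lra.
  - by move=> s /hR; lra.
  - by rewrite /J -catA EW perm_cat2l perm_cat2r.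
(* Since [t < hi <= 2 / 5], the point [1 - hi] lies in [t, 1 - t), which every item of size [1 - t]
   covers. *)
have loadJ : (load (placed W) (1 - hi) + size Rs + size Ls <= alg_cost A J)%N.
  apply: leq_trans (load_le_alg_cost J (1 - hi) _); last by lra.
  apply: leq_trans (load_placed_nseq _ _ _ _ hI ht _); last by lra.
  by rewrite leq_add2r cR //; lra.
have hz : 3 / 5 <= 1 - hi <= 3 / 5 + e by lra.
(* With l small items, [OPT] is at most 96k for l <= 72k, against a cost of at least 120k. For
   larger l the fifths matter: the cost exceeds 50k + l, while twice [OPT] is at most 120k + l +
   1. *)
exact: (final_load_bound _ _ _ _ _ _ _ _ (cross _ hz) loadS szLR hRs2).
Qed.

End Adversary.

Theorem theorem3 (R : realType) (A : online_algorithm R) :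
  ((5 / 4 : R)%:E <= asymptotic_competitive_ratio A)%E.
Proof.
(* The upper limit is an infimum over sets [V] containing all indices from some [n] on; the bad
   input for this [n] bounds the supremum over [V]. *)
apply/le_ereal_inf_tmp => _ [V [n _ nV] <-].
apply: le_ereal_sup_tmp; eexists; first by exists n => //; apply: nV => /=.
apply: le_ereal_sup_tmp.
have [I [hI [nOPT hcost]]] := bad_input R A n.
eexists; first by exists I, hI; split; [exact: ltnW | reflexivity].
rewrite lee_fin ler_pdivlMr ?ltr0n ?(leq_ltn_trans _ nOPT) //.
have : (5 * OPT hI)%N%:R <= (4 * alg_cost A I)%N%:R :> R by rewrite ler_nat.
by rewrite !natrM; lra.
Qed.
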